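(* There exist a field $k$ of characteristic zero and a finite-dimensional Hopf algebra $H$ over $k$ for which the second lazy cohomology group $\mathrm{H}^2_\ell(H)$ is not abelian.
   Context: Let $H$ be a Hopf algebra over $k$ with counit $\varepsilon$; write $\Delta(x)=\sum x_1\otimes x_2$. Under the convolution product $(\lambda\mu)(x)=\sum\lambda(x_1)\mu(x_2)$, $\mathrm{Hom}_k(H,k)$ is a monoid with unit $\varepsilon$; $\mathrm{Reg}(H)$ is its group of invertible elements, and $\mathrm{Reg}(H\otimes H)$ is defined similarly for the Hopf algebra $H\otimes H$. $\mathrm{Reg}^1_\ell(H)$ is the subgroup of those $\lambda\in\mathrm{Reg}(H)$ with $\sum\lambda(x_1)x_2=\sum\lambda(x_2)x_1$ for all $x\in H$. $\mathrm{Reg}^2_\ell(H)$ is the subgroup of those $\sigma\in\mathrm{Reg}(H\otimes H)$ with $\sum\sigma(x_1\otimes y_1)x_2y_2=\sum\sigma(x_2\otimes y_2)x_1y_1$ for all $x,y\in H$. $Z^2_\ell(H)$ is the set of $\sigma\in\mathrm{Reg}^2_\ell(H)$ with $\sum\sigma(x_1\otimes y_1)\sigma(x_2y_2\otimes z)=\sum\sigma(y_1\otimes z_1)\sigma(x\otimes y_2z_2)$ for all $x,y,z\in H$; it is a group under convolution. For $\lambda\in\mathrm{Reg}^1_\ell(H)$ put $\partial(\lambda)(x\otimes y)=\sum\lambda(x_1)\lambda(y_1)\lambda^{-1}(x_2y_2)$, where $\lambda^{-1}$ is the convolution inverse; $\partial$ is a homomorphism whose image $B^2_\ell(H)$ is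 a central subgroup of $Z^2_\ell(H)$. Finally $\mathrm{H}^2_\ell(H)=Z^2_\ell(H)/B^2_\ell(H)$. *)

(* Defs.v *)
From HB Require Import structures.
From mathcomp Require Import all_boot all_order all_algebra falgebra.
From mathcomp Require Import classical_sets.

Set Implicit Arguments.
Unset Strict Implicit.
Unset Printing Implicit Defensive.

Import GRing.Theory.
Local Open Scope ring_scope.

Reserved Notation "x ⊗ y" (at level 40, left associativity).
Reserved Notation "\Sw_ ( x1 , x2 <- x ) E"
  (at level 41, x1 name, x2 name, E at level 41, right associativity,
   format "'[' \Sw_ ( x1 ,  x2  <-  x ) '/  '  E ']'").

Section Tensor.
Variable k : fieldType.

(* V ⊗ W is modelled by matrices of coordinates: if (e_i) and (f_j) are the
   bases [vbasis {:V}] and [vbasis {:W}], then t stands for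
   \sum_(i, j) t i j *: (e_i ⊗ f_j). *)
Definition tensor (V W : vectType k) : Type :=
  'M[k]_(\dim {:V}, \dim {:W}).

HB.instance Definition _ (V W : vectType k) := Vector.on (tensor V W).

Definition tens (V W : vectType k) (x : V) (y : W) : tensor V W :=
  \matrix_(i, j) (coord (vbasis {:V}) i x * coord (vbasis {:W}) j y).

(* The linear map V ⊗ W -> U induced by f; it is meant for bilinear f, see
   [tlift_tens]. *)
Definition tlift (V W : vectType k) (U : lmodType k) (f : V -> W -> U)
    (t : tensor V W) : U :=
  \sum_i \sum_j t i j *: f (vbasis {:V})`_i (vbasis {:W})`_j.

End Tensor.

Notation "x ⊗ y" := (tens x y) : ring_scope.

Section TensorTheory.
Variable k : fieldType.
Implicit Types V W X : vectType k.
Implicit Types U : lmodType k.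

Lemma tlift_is_linear V W U (f : V -> W -> U) : linear (tlift f).
Proof.
move=> a s t; rewrite /tlift scaler_sumr -big_split /=.
apply: eq_bigr => i _; rewrite scaler_sumr -big_split /=.
by apply: eq_bigr => j _; rewrite !mxE scalerDl scalerA.
Qed.

HB.instance Definition _ V W U (f : V -> W -> U) :=
  GRing.isLinear.Build k (tensor V W) U *:%R (tlift f) (tlift_is_linear f).

Lemma eq_tlift V W U (f g : V -> W -> U) t :
  f =2 g -> tlift f t = tlift g t.
Proof.
by move=> fg; apply: eq_bigr => i _; apply: eq_bigr => j _; rewrite fg.
Qed.

Lemma linear_tlift V W U U' (g : {linear U -> U'}) (f : V -> W -> U) t :
  g (tlift f t) = tlift (fun x y => g (f x y)) t.
Proof.
rewrite /tlift linear_sum; apply: eq_bigr => i _.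
by rewrite linear_sum; apply: eq_bigr => j _; rewrite linearZ.
Qed.

Lemma linear_tliftF V W U U' (g : U -> U') (f : V -> W -> U) t :
  linear g -> g (tlift f t) = tlift (fun x y => g (f x y)) t.
Proof.
move=> lg; pose gL : {linear U -> U'} :=
  HB.pack g (GRing.isLinear.Build k U U' *:%R g lg).
exact: (linear_tlift gL).
Qed.

Lemma tlift_exchange V W V' W' U (f : V -> W -> V' -> W' -> U) s t :
  tlift (fun x y => tlift (f x y) t) s =
  tlift (fun x' y' => tlift (fun x y => f x y x' y') s) t.
Proof.
have E (p p' q q' : nat) (F : 'I_p -> 'I_q -> 'I_p' -> 'I_q' -> U)
    (a : 'I_p -> 'I_q -> k) (b : 'I_p' -> 'I_q' -> k) :
  \sum_i \sum_j a i j *: (\sum_i' \sum_j' b i' j' *: F i j i' j') =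
  \sum_i' \sum_j' b i' j' *: (\sum_i \sum_j a i j *: F i j i' j').
  transitivity (\sum_(u : 'I_p * 'I_q) \sum_(v : 'I_p' * 'I_q')
      (a u.1 u.2 * b v.1 v.2) *: F u.1 u.2 v.1 v.2).
    rewrite [LHS]pair_bigA; apply: eq_bigr => u _ /=.
    rewrite pair_bigA scaler_sumr; apply: eq_bigr => v _ /=.
    by rewrite scalerA.
  rewrite exchange_big [RHS]pair_bigA; apply: eq_bigr => v _ /=.
  rewrite pair_bigA scaler_sumr; apply: eq_bigr => u _ /=.
  by rewrite scalerA mulrC.
exact: E.
Qed.

Lemma tlift_linearP V W U V' (f : V' -> V -> W -> U) t :
  (forall x y, linear (fun z => f z x y)) -> linear (fun z => tlift (f z) t).
Proof.
move=> lf a u v; rewrite /tlift scaler_sumr -big_split /=.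
apply: eq_bigr => i _; rewrite scaler_sumr -big_split /=.
apply: eq_bigr => j _; rewrite lf scalerDr; congr (_ + _).
by rewrite !scalerA mulrC.
Qed.

Lemma tlift_tens V W U (f : V -> W -> U) x y :
  (forall x, linear (f x)) -> (forall y, linear (f^~ y)) ->
  tlift f (x ⊗ y) = f x y.
Proof.
move=> lr ll.
have sumE (V0 : vectType k) (g : V0 -> U) v : linear g ->
    g v = \sum_i coord (vbasis {:V0}) i v *: g (vbasis {:V0})`_i.
  move=> lg; pose gL : {linear V0 -> U} :=
    HB.pack g (GRing.isLinear.Build k V0 U *:%R g lg).
  rewrite -[LHS]/(gL v) {1}(coord_vbasis (memvf v)) linear_sum.
  by apply: eq_bigr => i _; rewrite linearZ.
rewrite (sumE _ _ x (ll y)); apply: eq_bigr => i _.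
rewrite (sumE _ _ y (lr _)) scaler_sumr; apply: eq_bigr => j _.
by rewrite mxE scalerA.
Qed.

Lemma tens_linearr V W (x : V) : linear (fun y : W => x ⊗ y).
Proof.
move=> a y z; apply/matrixP=> i j.
by rewrite !mxE linearP /= mulrDr mulrCA.
Qed.

Lemma tens_linearl V W (y : W) : linear (fun x : V => x ⊗ y).
Proof.
move=> a x z; apply/matrixP=> i j.
by rewrite !mxE linearP /= mulrDl mulrA.
Qed.

Lemma tlift_id V W (t : tensor V W) : tlift (@tens k V W) t = t.
Proof.
apply/matrixP=> i j; rewrite /tlift summxE (bigD1 i) //= summxE (bigD1 j) //=.
have co (V0 : vectType k) (a b : 'I_(\dim {:V0})) :
    coord (vbasis {:V0}) a (vbasis {:V0})`_b = (a == b)%:R.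
  by rewrite coord_free ?(basis_free (vbasisP _)) 1?eq_sym.
rewrite !mxE !co !eqxx !mulr1 !big1 ?addr0 // => [i' ne|j' ne].
  rewrite summxE big1 // => j' _.
  by rewrite !mxE !co eq_sym (negPf ne) mul0r mulr0.
by rewrite !mxE !co [j == _]eq_sym (negPf ne) !mulr0.
Qed.

(* Linear maps on V ⊗ W are determined by their values on pure tensors. *)
Lemma tensor_ext V W U (f g : tensor V W -> U) : linear f -> linear g ->
  (forall x y, f (x ⊗ y) = g (x ⊗ y)) -> f =1 g.
Proof.
move=> lf lg fg t; rewrite -[t]tlift_id (linear_tliftF _ _ lf).
by rewrite (linear_tliftF _ _ lg); apply: eq_tlift.
Qed.

End TensorTheory.

(* A nonzero finite-dimensional coalgebra; the zero coalgebra is left out so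
   that the convolution algebra is a nontrivial ring.  In the coassociativity
   axiom, the two triple tensors are bracketed to the right. *)
HB.mixin Record Vector_isCoalgebra (k : fieldType) C of Vector k C := {
  comul : 'Hom(C, tensor C C);
  counit : 'Hom(C, k^o);
  comulA : forall x,
    tlift (fun x1 x2 => tlift (fun x11 x12 => x11 ⊗ (x12 ⊗ x2)) (comul x1))
      (comul x) =
    tlift (fun x1 x2 => tlift (fun x21 x22 => x1 ⊗ (x21 ⊗ x22)) (comul x2))
      (comul x);
  counitl : forall x, tlift (fun x1 x2 => (counit x1 : k) *: x2) (comul x) = x;
  counitr : forall x, tlift (fun x1 x2 => (counit x2 : k) *: x1) (comul x) = x;
  counit_neq0 : counit != 0
}.

#[short(type="coalgType")]
HB.structure Definition Coalgebra (k : fieldType) :=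
  { C of Vector k C & Vector_isCoalgebra k C }.

(* Sweedler's notation: \Sw_(x1, x2 <- x) f x1 x2 is \sum f(x_1, x_2). *)
Notation "\Sw_ ( x1 , x2 <- x ) E" :=
  (tlift (fun x1 x2 => E) (comul x)) : ring_scope.

HB.mixin Record Coalgebra_isHopf (k : fieldType) H
    of Falgebra k H & Coalgebra k H := {
  antipode : 'End(H);
  comul1 : comul (1 : H) = 1 ⊗ 1;
  comulM : forall x y : H,
    comul (x * y) =
    \Sw_(x1, x2 <- x) \Sw_(y1, y2 <- y) (x1 * y1) ⊗ (x2 * y2);
  counit1 : counit (1 : H) = 1;
  counitM : forall x y : H, counit (x * y) = counit x * counit y;
  antipodel : forall x : H,
    \Sw_(x1, x2 <- x) (antipode x1 * x2) = (counit x : k)%:A;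
  antipoder : forall x : H,
    \Sw_(x1, x2 <- x) (x1 * antipode x2) = (counit x : k)%:A
}.

#[short(type="hopfAlgType")]
HB.structure Definition HopfAlgebra (k : fieldType) :=
  { H of Falgebra k H & Coalgebra k H & Coalgebra_isHopf k H }.

Lemma scale_regE (k : fieldType) (a : k) (b : k^o) : a *: b = a * b :> k.
Proof. by []. Qed.

Lemma tensPl (k : fieldType) (V W : vectType k) a (x z : V) (y : W) :
  (a *: x + z) ⊗ y = a *: (x ⊗ y) + z ⊗ y.
Proof. exact: tens_linearl. Qed.

Lemma tensPr (k : fieldType) (V W : vectType k) a (x : V) (y z : W) :
  x ⊗ (a *: y + z) = a *: (x ⊗ y) + x ⊗ z.
Proof. exact: tens_linearr. Qed.

(* Proves that a function built from linear maps, ⊗, products, scalings and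
   Sweedler sums is linear. *)
Ltac lin := intros; cbv beta;
  first
  [ solve [auto]
  | by move=> ? ? ?; rewrite /= ?linearP /= ?linearP /= ?(tensPl, tensPr)
  | by move=> ? ? ?;
       rewrite /= ?(mulrDl, mulrDr) -?scalerAl -?scalerAr ?(tensPl, tensPr)
  | exact: tens_linearl
  | exact: tens_linearr
  | apply: tlift_linearP => ? ?; lin
  | let a := fresh "a" in intros a ? ?;
    rewrite /= ?(tensPl, tensPr) ?linearP /= ?(tensPl, tensPr)
      ?(mulrDl, mulrDr, scalerDl, scalerDr) ?linearP /=;
    congr (_ + _);
    first [ done | by rewrite -scalerAr | by rewrite -scalerAl
          | by rewrite !scale_regE ?mulrA ?(mulrC _ a) ?mulrA
          | by rewrite !scalerA mulrC | by rewrite scalerA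
          | by rewrite scale_regE scalerA ] ].

Lemma tlift_tlift (k : fieldType) (V W V' W' : vectType k) (U : lmodType k)
    (F : V' -> W' -> U) (f : V -> W -> tensor V' W') t :
  tlift F (tlift f t) = tlift (fun x y => tlift F (f x y)) t.
Proof. exact: linear_tlift. Qed.

Section CoalgebraTheory.
Variables (k : fieldType) (C : coalgType k).
Implicit Types x y : C.

Lemma coassoc (U : lmodType k) (F : C -> C -> C -> U) x :
  (forall y z, linear (fun x => F x y z)) ->
  (forall x z, linear (fun y => F x y z)) ->
  (forall x y, linear (F x y)) ->
  \Sw_(x1, x2 <- x) \Sw_(x11, x12 <- x1) F x11 x12 x2 =
  \Sw_(x1, x2 <- x) \Sw_(x21, x22 <- x2) F x1 x21 x22.
Proof.
move=> l1 l2 l3; pose G := tlift (fun x => tlift (F x)).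
have GE a b c : G (a ⊗ (b ⊗ c)) = F a b c.
  rewrite /G tlift_tens ?tlift_tens //; lin.
have lG : linear G by rewrite /G; lin.
have GS (s : tensor C C) z :
    G (tlift (fun u v => u ⊗ (v ⊗ z)) s) = tlift (fun u v => F u v z) s.
  by rewrite (linear_tliftF _ _ lG); apply: eq_tlift => u v; rewrite GE.
have GS' (s : tensor C C) z :
    G (tlift (fun u v => z ⊗ (u ⊗ v)) s) = tlift (F z) s.
  by rewrite (linear_tliftF _ _ lG); apply: eq_tlift => u v; rewrite GE.
move: (congr1 G (comulA x)); rewrite !(linear_tliftF _ _ lG).
under eq_tlift => u v do rewrite GS.
by under [RHS]eq_tlift => u v do rewrite GS'.
Qed.

End CoalgebraTheory.

Section TensorCoalgebra.
Variables (k : fieldType) (C D : coalgType k).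
Local Notation CD := (tensor C D).

Definition tensor_comul : 'Hom(CD, tensor CD CD) :=
  linfun (tlift (fun (x : C) (y : D) =>
    \Sw_(x1, x2 <- x) \Sw_(y1, y2 <- y) (x1 ⊗ y1) ⊗ (x2 ⊗ y2))).

Definition tensor_counit : 'Hom(CD, k^o) :=
  linfun (tlift (fun (x : C) (y : D) => counit x * counit y)).

Lemma tensor_comulE (x : C) (y : D) :
  tensor_comul (x ⊗ y) =
  \Sw_(x1, x2 <- x) \Sw_(y1, y2 <- y) (x1 ⊗ y1) ⊗ (x2 ⊗ y2).
Proof. by rewrite lfunE /= tlift_tens //; lin. Qed.

Lemma tensor_counitE (x : C) (y : D) :
  tensor_counit (x ⊗ y) = counit x * counit y.
Proof. rewrite lfunE /= tlift_tens //; lin. Qed.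

Lemma tensor_SwE (U : lmodType k) (F : CD -> CD -> U) (x : C) (y : D) :
  (forall s, linear (F s)) -> (forall t, linear (F^~ t)) ->
  tlift F (tensor_comul (x ⊗ y)) =
  \Sw_(x1, x2 <- x) \Sw_(y1, y2 <- y) F (x1 ⊗ y1) (x2 ⊗ y2).
Proof.
move=> lr ll; rewrite tensor_comulE tlift_tlift.
apply: eq_tlift => x1 x2; rewrite tlift_tlift.
by apply: eq_tlift => y1 y2; rewrite tlift_tens.
Qed.

Lemma tensor_comulA (t : CD) :
  tlift (fun t1 t2 =>
    tlift (fun t11 t12 => t11 ⊗ (t12 ⊗ t2)) (tensor_comul t1))
    (tensor_comul t) =
  tlift (fun t1 t2 =>
    tlift (fun t21 t22 => t1 ⊗ (t21 ⊗ t22)) (tensor_comul t2))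
    (tensor_comul t).
Proof.
move: t; apply: (@tensor_ext _ _ _ _ (fun t => tlift _ (tensor_comul t))
  (fun t => tlift _ (tensor_comul t))) => [||x y]; [lin|lin|].
rewrite !tensor_SwE; try lin.
pose T (x1 x2 x3 : C) (y1 y2 y3 : D) :=
  (x1 ⊗ y1) ⊗ ((x2 ⊗ y2) ⊗ (x3 ⊗ y3)).
transitivity (\Sw_(x1, x2 <- x) \Sw_(x11, x12 <- x1)
  \Sw_(y1, y2 <- y) \Sw_(y11, y12 <- y1) T x11 x12 x2 y11 y12 y2).
  apply: eq_tlift => x1 x2; rewrite -tlift_exchange.
  by apply: eq_tlift => y1 y2; rewrite tensor_SwE; lin.
rewrite (coassoc (F := fun x1 x2 x3 => \Sw_(y1, y2 <- y)
  \Sw_(y11, y12 <- y1) T x1 x2 x3 y11 y12 y2)); try (rewrite /T; lin).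
apply: eq_tlift => x1 x2.
under eq_tlift => x21 x22 do
  (rewrite (coassoc (F := T x1 x21 x22)); try (rewrite /T; lin)).
rewrite tlift_exchange; apply: eq_tlift => y1 y2.
by rewrite tensor_SwE //; lin.
Qed.

Lemma tensor_counitl (t : CD) :
  tlift (fun t1 t2 => (tensor_counit t1 : k) *: t2) (tensor_comul t) = t.
Proof.
move: t; apply: (@tensor_ext _ _ _ _ (fun t => tlift _ (tensor_comul t))
  idfun) => [||x y]; [lin|lin|].
rewrite tensor_SwE; try lin.
rewrite -{2}[x]counitl -{2}[y]counitl (linear_tliftF _ _ (tens_linearl _)).
apply: eq_tlift => x1 x2; rewrite (linear_tliftF _ _ (tens_linearr _)).
apply: eq_tlift => y1 y2; rewrite tensor_counitE.
by apply/matrixP=> i j; rewrite !mxE !linearZ /= mulrACA.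
Qed.

Lemma tensor_counitr (t : CD) :
  tlift (fun t1 t2 => (tensor_counit t2 : k) *: t1) (tensor_comul t) = t.
Proof.
move: t; apply: (@tensor_ext _ _ _ _ (fun t => tlift _ (tensor_comul t))
  idfun) => [||x y]; [lin|lin|].
rewrite tensor_SwE; try lin.
rewrite -{2}[x]counitr -{2}[y]counitr (linear_tliftF _ _ (tens_linearl _)).
apply: eq_tlift => x1 x2; rewrite (linear_tliftF _ _ (tens_linearr _)).
apply: eq_tlift => y1 y2; rewrite tensor_counitE.
by apply/matrixP=> i j; rewrite !mxE !linearZ /= mulrACA.
Qed.

Lemma tensor_counit_neq0 : tensor_counit != 0.
Proof.
have [x x0] := lfunPn (counit_neq0 (s := C)).
have [y y0] := lfunPn (counit_neq0 (s := D)).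
rewrite !lfunE /= in x0 y0.
apply/lfunPn; exists (x ⊗ y); rewrite tensor_counitE lfunE /=.
exact: mulf_neq0.
Qed.

HB.instance Definition _ := Vector_isCoalgebra.Build k CD
  tensor_comulA tensor_counitl tensor_counitr tensor_counit_neq0.

End TensorCoalgebra.

Lemma linear_linfunE (k : fieldType) (V W : vectType k) (f : V -> W) x :
  linear f -> linfun f x = f x.
Proof.
move=> lf; pose L : {linear V -> W} :=
  HB.pack f (GRing.isLinear.Build k V W *:%R f lf).
exact: (lfunE L).
Qed.

(* Hom_k(C, k), made below into a ring whose product is convolution and whose 1
   is the counit; in particular ^-1 is the convolution inverse. *)
Definition dual (k : fieldType) (C : coalgType k) : Type := 'Hom(C, k^o).

Section Convolution.
Variables (k : fieldType) (C : coalgType k).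
Local Notation dualC := (dual C).
Implicit Types f g h : dualC.

HB.instance Definition _ := Vector.on dualC.

Lemma dualP f g : f =1 g <-> f = g.
Proof. exact: lfunP. Qed.

Definition conv f g : dualC := linfun (fun x => \Sw_(x1, x2 <- x) f x1 * g x2).

Definition conv1 : dualC := counit.

Lemma convE f g x : conv f g x = \Sw_(x1, x2 <- x) f x1 * g x2.
Proof.
by rewrite (linear_linfunE (f := fun x => _)) //; lin.
Qed.

Lemma convA : associative conv.
Proof.
move=> f g h; apply/dualP=> x; rewrite !convE; symmetry.
transitivity (\Sw_(x1, x2 <- x) \Sw_(x11, x12 <- x1) f x11 * g x12 * h x2).
  apply: eq_tlift => x1 x2; rewrite convE.
  by rewrite (linear_tliftF (g := fun z : k^o => z * h x2)) //; lin.
rewrite (coassoc (F := fun x1 x2 x3 => f x1 * g x2 * h x3)); try lin.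
apply: eq_tlift => x1 x2; rewrite convE.
rewrite (linear_tliftF (g := fun z : k^o => f x1 * z)); last by lin.
by apply: eq_tlift => x21 x22; rewrite mulrA.
Qed.

Lemma conv1l : left_id conv1 conv.
Proof.
move=> f; apply/dualP=> x; rewrite convE -{2}[x]counitl.
by rewrite (linear_tlift f); apply: eq_tlift => x1 x2; rewrite linearZ.
Qed.

Lemma conv1r : right_id conv1 conv.
Proof.
move=> f; apply/dualP=> x; rewrite convE -{2}[x]counitr.
rewrite (linear_tlift f); apply: eq_tlift => x1 x2.
by rewrite linearZ /= mulrC.
Qed.

Lemma tliftDf (V W : vectType k) (U : lmodType k) (F G : V -> W -> U) t :
  tlift (fun x y => F x y + G x y) t = tlift F t + tlift G t.
Proof.
rewrite /tlift -big_split; apply: eq_bigr => i _ /=.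
by rewrite -big_split; apply: eq_bigr => j _; rewrite scalerDr.
Qed.

Lemma convDl : left_distributive conv +%R.
Proof.
move=> f g h; apply/dualP=> x; rewrite lfunE /= !convE -tliftDf.
by apply: eq_tlift => x1 x2; rewrite lfunE /= mulrDl.
Qed.

Lemma convDr : right_distributive conv +%R.
Proof.
move=> f g h; apply/dualP=> x; rewrite lfunE /= !convE -tliftDf.
by apply: eq_tlift => x1 x2; rewrite lfunE /= mulrDr.
Qed.

HB.instance Definition _ := GRing.Zmodule_isNzRing.Build dualC
  convA conv1l conv1r convDl convDr counit_neq0.

Lemma convZl (a : k) f g : a *: (f * g) = (a *: f) * g.
Proof.
apply/dualP=> x; rewrite lfunE /= !convE (linear_tliftF (g := *:%R a)).
  by apply: eq_tlift => x1 x2; rewrite lfunE /= scalerAl.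
exact: linearP.
Qed.

Lemma convZr (a : k) f g : a *: (f * g) = f * (a *: g).
Proof.
apply/dualP=> x; rewrite lfunE /= !convE (linear_tliftF (g := *:%R a)).
  by apply: eq_tlift => x1 x2; rewrite lfunE /= scalerAr.
exact: linearP.
Qed.

HB.instance Definition _ := GRing.Lmodule_isLalgebra.Build k dualC convZl.
HB.instance Definition _ := GRing.Lalgebra_isAlgebra.Build k dualC convZr.
HB.instance Definition _ := Algebra_isFalgebra.Build k dualC.

Lemma dual_mulE f g x : (f * g) x = \Sw_(x1, x2 <- x) f x1 * g x2.
Proof. exact: convE. Qed.

Lemma dual_oneE x : (1 : dualC) x = counit x.
Proof. by []. Qed.

End Convolution.

Definition Reg (k : fieldType) (C : coalgType k) : set (dual C) :=
  [set f | f \is a GRing.unit]%classic.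

Arguments Reg {k} C _.

Section LazyCohomology.
Variables (k : fieldType) (H : hopfAlgType k).
Local Notation HH := (tensor H H).
Local Open Scope classical_set_scope.

Definition lazyReg1 : set (dual H) :=
  [set l | Reg H l /\
    forall x : H,
      \Sw_(x1, x2 <- x) (l x1 : k) *: x2 = \Sw_(x1, x2 <- x) (l x2 : k) *: x1].

Definition lazyReg2 : set (dual HH) :=
  [set s | Reg HH s /\
    forall x y : H,
      \Sw_(x1, x2 <- x) \Sw_(y1, y2 <- y) (s (x1 ⊗ y1) : k) *: (x2 * y2) =
      \Sw_(x1, x2 <- x) \Sw_(y1, y2 <- y) (s (x2 ⊗ y2) : k) *: (x1 * y1)].

Definition lazyZ2 : set (dual HH) :=
  [set s | lazyReg2 s /\
    forall x y z : H,
      \Sw_(x1, x2 <- x) \Sw_(y1, y2 <- y) s (x1 ⊗ y1) * s ((x2 * y2) ⊗ z) =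
      \Sw_(y1, y2 <- y) \Sw_(z1, z2 <- z) s (y1 ⊗ z1) * s (x ⊗ (y2 * z2))].

Definition coboundary (l : dual H) : dual HH :=
  linfun (tlift (fun x y : H =>
    \Sw_(x1, x2 <- x) \Sw_(y1, y2 <- y) l x1 * l y1 * l^-1 (x2 * y2))).

Lemma coboundaryE (l : dual H) (x y : H) :
  coboundary l (x ⊗ y) =
  \Sw_(x1, x2 <- x) \Sw_(y1, y2 <- y) l x1 * l y1 * l^-1 (x2 * y2).
Proof. by rewrite lfunE /= tlift_tens //; lin. Qed.

Definition lazyB2 : set (dual HH) := coboundary @` lazyReg1.

(* The quotient group Z^2/B^2: its elements are the cosets of B^2 in Z^2, and
   the product of two cosets is their setwise product. *)
Definition lazyH2 : set (set (dual HH)) :=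
  [set [set s * b | b in lazyB2] | s in lazyZ2].

Definition coset_mul (A B : set (dual HH)) : set (dual HH) :=
  [set a * b | a in A & b in B].

End LazyCohomology.

Arguments lazyReg1 {k} H _.
Arguments lazyReg2 {k} H _.
Arguments lazyZ2 {k} H _.
Arguments lazyB2 {k} H _.
Arguments lazyH2 {k} H _.

(* Main.v *)
(* Dually to H, lazy 2-cocycles are the invertible F in A ⊗ A, A the dual of H,
   that satisfy the twist equation and commute with Δ(A).  Two kinds are played
   off against each other for A = k^L # K, where K = F_3^2 acts on L = F_3^4 by
   (s, t).(x1, x2, y1, y2) = (x1 + s y1, x2 + t y1 + s y2, y1, y2).

   The shear T : x1 |-> x1 + y1 of L does not come from K, but it preserves each
   K-orbit, so it is implemented by conjugation by a unit a of A that normalizes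
   the Hopf structure; then F_T = (a ⊗ a) Δ(a^-1) is a lazy twist.  A K-invariant
   alternating bicharacter β of L, seen in k^L ⊗ k^L, is a lazy twist as well.
   Their commutator is (β o T) / β.  As H is commutative, coboundaries and F_T are
   symmetric under the flip, whereas the alternating bicharacter (β o T) / β is
   not for the β chosen below, so the two classes do not commute. *)
Require Import Defs.
From HB Require Import structures.
From mathcomp Require Import all_boot all_order all_algebra all_field falgebra.
From mathcomp Require Import classical_sets.
From mathcomp Require Import ring.

Set Implicit Arguments.
Unset Strict Implicit.
Unset Printing Implicit Defensive.

Import GRing.Theory.
Local Open Scope ring_scope.

Lemma linear_sumF (k : fieldType) (U V : lmodType k) (f : U -> V)
    (I : Type) (r : seq I) (P : pred I) (E : I -> U) : linear f ->
  f (\sum_(i <- r | P i) E i) = \sum_(i <- r | P i) f (E i).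
Proof.
move=> lf; pose fL : {linear U -> V} :=
  HB.pack f (GRing.isLinear.Build k U V *:%R f lf).
exact: (linear_sum fL).
Qed.

Lemma tens0l (k : fieldType) (V W : vectType k) (y : W) : (0 : V) ⊗ y = 0.
Proof. by apply/matrixP=> i j; rewrite !mxE linear0 mul0r. Qed.

Lemma tens0r (k : fieldType) (V W : vectType k) (x : V) : x ⊗ (0 : W) = 0.
Proof. by apply/matrixP=> i j; rewrite !mxE linear0 mulr0. Qed.

(** * The dual of a smash product *)

Record additive_action (L K : finZmodType) := AdditiveAction {
  aact :> K -> L -> L;
  aact0 : aact 0 =1 id;
  aactD : forall a b l, aact (a + b) l = aact a (aact b l);
  aactDr : forall a l m, aact a (l + m) = aact a l + aact a m
}.

(* The Hopf algebra dual to the smash product k^L # K; [bu l a] below is the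
   basis dual to the elements 1_l # a. *)
Definition bismash (k : fieldType) (L K : finZmodType)
  (act : additive_action L K) : Type := {ffun L * K -> k^o}.

Section Bismash.
Variables (k : fieldType) (L K : finZmodType) (act : additive_action L K).
Local Notation H := (bismash k act).

HB.instance Definition _ := Vector.on H.

(** * Basis vectors and linear extension from them *)

Definition bu (l : L) (a : K) : H := [ffun i => (i == (l, a))%:R].

Definition bext (U : lmodType k) (F : L -> K -> U) (x : H) : U :=
  \sum_i (x i : k) *: F i.1 i.2.

Lemma bext_linear (U : lmodType k) (F : L -> K -> U) : linear (bext F).
Proof.
move=> a x y; rewrite /bext scaler_sumr -big_split /=.
by apply: eq_bigr => i _; rewrite !ffunE scalerDl scalerA.
Qed.

HB.instance Definition _ (U : lmodType k) (F : L -> K -> U) :=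
  GRing.isLinear.Build k H U *:%R (bext F) (@bext_linear U F).

Lemma bext_bu (U : lmodType k) (F : L -> K -> U) l a : bext F (bu l a) = F l a.
Proof.
rewrite /bext (bigD1 (l, a)) //= ffunE eqxx scale1r big1 ?addr0 // => i ne.
by rewrite ffunE (negPf ne) scale0r.
Qed.

Lemma bext_id x : bext bu x = x.
Proof.
apply/ffunP=> i; rewrite sum_ffunE (bigD1 i) //= !ffunE.
rewrite -surjective_pairing eqxx big1 ?addr0 => [|j ne].
  exact: mulr1.
by rewrite !ffunE -surjective_pairing eq_sym (negPf ne); apply: mulr0.
Qed.

Lemma bu_ext (U : lmodType k) (f g : H -> U) : linear f -> linear g ->
  (forall l a, f (bu l a) = g (bu l a)) -> f =1 g.
Proof.
move=> lf lg fg x.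
have E (h : H -> U) : linear h -> h x = bext (fun l a => h (bu l a)) x.
  move=> lh; pose hL : {linear H -> U} :=
    HB.pack h (GRing.isLinear.Build k H U *:%R h lh).
  rewrite -{1}[x]bext_id -[LHS]/(hL _) linear_sum.
  by apply: eq_bigr => i _; rewrite linearZ.
by rewrite (E f) // (E g) //; apply: eq_bigr => i _; rewrite fg.
Qed.

Lemma bext_linearP (V U : lmodType k) (F : V -> L -> K -> U) x :
  (forall l a, linear (fun v => F v l a)) -> linear (fun v => bext (F v) x).
Proof.
move=> lF c u v; rewrite /bext scaler_sumr -big_split /=.
apply: eq_bigr => i _; rewrite lF scalerDr; congr (_ + _).
by rewrite !scalerA mulrC.
Qed.

(** As an algebra, H is k[L] ⊗ k^K, with [bu l a] standing for l ⊗ δ_a. This is dual to the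
    coproduct of k^L # K, for which the elements of K are grouplike; H is commutative because L
    is. *)
Definition bmul (x y : H) : H :=
  bext (fun l a => bext (fun m b => if a == b then bu (l + m) a else 0) y) x.

Lemma bmul_linearl y : linear (bmul^~ y).
Proof. exact: bext_linear. Qed.

Lemma bmul_linearr x : linear (bmul x).
Proof. by apply: bext_linearP => l a; apply: bext_linear. Qed.

Lemma bmul_bu l a m b :
  bmul (bu l a) (bu m b) = if a == b then bu (l + m) a else 0.
Proof. by rewrite /bmul !bext_bu. Qed.

Lemma bmulA : associative bmul.
Proof.
have l0 := bmul_linearl; have r0 := bmul_linearr.
move=> x y z; move: x.
apply: (@bu_ext H (fun x => bmul x (bmul y z)) (fun x => bmul (bmul x y) z)).
- by [].
- by move=> c u v; rewrite !l0.
move=> l a; move: y.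
apply: (@bu_ext H (fun y => bmul _ (bmul y z)) (fun y => bmul (bmul _ y) z)).
- by move=> c u v; rewrite l0 r0.
- by move=> c u v; rewrite r0 l0.
move=> m b; move: z.
apply: (@bu_ext H (fun z => bmul _ (bmul _ z)) (fun z => bmul (bmul _ _) z)).
- by move=> c u v; rewrite !r0.
- by [].
have bmul0 x : bmul x 0 = 0.
  by have := r0 x (-1) 0 0; rewrite !scaleN1r oppr0 addr0 addNr.
have bmul0l x : bmul 0 x = 0.
  by have := l0 x (-1) 0 0; rewrite !scaleN1r oppr0 addr0 addNr.
move=> n c; rewrite !bmul_bu.
have [->|ab] := eqVneq a b; have [<-|bc] := eqVneq b c.
- by rewrite !bmul_bu eqxx addrA.
- by rewrite bmul_bu bmul0 (negPf bc).
- by rewrite bmul_bu bmul0l (negPf ab).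
- by rewrite bmul0 bmul0l.
Qed.

Lemma bmulC : commutative bmul.
Proof.
have l0 := bmul_linearl; have r0 := bmul_linearr.
move=> x y; move: x.
apply: (@bu_ext H (fun x => bmul x y) (fun x => bmul y x)) => //.
move=> l a; move: y.
apply: (@bu_ext H (fun y => bmul _ y) (fun y => bmul y _)) => //.
by move=> m b; rewrite !bmul_bu eq_sym addrC; case: eqP => // ->.
Qed.

Definition bone : H := \sum_a bu 0 a.

Lemma bmul1 : left_id bone bmul.
Proof.
apply: (@bu_ext H (bmul bone) idfun) => [||l a] //; first exact: bmul_linearr.
rewrite bmulC /bone; pose f : {linear H -> H} := HB.pack (bmul (bu l a))
  (GRing.isLinear.Build k H H *:%R _ (bmul_linearr (bu l a))).
rewrite -[LHS]/(f _) linear_sum (bigD1 a) //= bmul_bu eqxx addr0.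
by rewrite big1 ?addr0 // => b ne; rewrite bmul_bu eq_sym (negPf ne).
Qed.

Lemma bmul1r : right_id bone bmul.
Proof. by move=> x; rewrite bmulC bmul1. Qed.

Lemma bmulDl : left_distributive bmul +%R.
Proof. by move=> x y z; have := bmul_linearl z 1 x y; rewrite !scale1r. Qed.

Lemma bmulDr : right_distributive bmul +%R.
Proof. by move=> x y z; have := bmul_linearr x 1 y z; rewrite !scale1r. Qed.

Lemma bone_neq0 : bone != 0.
Proof.
apply/eqP=> /ffunP /(_ (0, 0)); rewrite sum_ffunE (bigD1 0) //= !ffunE eqxx.
rewrite big1 ?addr0 => [|a ne]; first exact/eqP/oner_neq0.
by rewrite ffunE xpair_eqE [0 == a]eq_sym (negPf ne) andbF.
Qed.

HB.instance Definition _ := GRing.Zmodule_isNzRing.Build H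
  bmulA bmul1 bmul1r bmulDl bmulDr bone_neq0.

Lemma bscaleAl (c : k) (x y : H) : c *: (x * y) = (c *: x) * y.
Proof.
have /= := bmul_linearl y c x 0; rewrite addr0 => E.
by rewrite [RHS]E -[bmul 0 y]/(0 * y) mul0r addr0.
Qed.

HB.instance Definition _ := GRing.Lmodule_isLalgebra.Build k H bscaleAl.

Lemma bscaleAr (c : k) (x y : H) : c *: (x * y) = x * (c *: y).
Proof. by rewrite [x * y]bmulC [RHS]bmulC [LHS]bscaleAl. Qed.

HB.instance Definition _ := GRing.Lalgebra_isAlgebra.Build k H bscaleAr.
HB.instance Definition _ := Algebra_isFalgebra.Build k H.

Lemma buM l a m b :
  bu l a * bu m b = if a == b then bu (l + m) a else 0 :> H.
Proof. exact: bmul_bu. Qed.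

Lemma bu1E : \sum_a bu 0 a = 1 :> H.
Proof. by []. Qed.

(** Dual to the smash product rule: (1_l # b)(1_m # c) is 1_l # (b + c) if l = b.m, and 0
    otherwise. *)
Definition bcomul : 'Hom(H, tensor H H) := linfun (bext (fun l a =>
  \sum_b bu l b ⊗ bu (act (- b) l) (a - b) : tensor H H)).

Lemma bcomul_bu l a :
  bcomul (bu l a) = \sum_b bu l b ⊗ bu (act (- b) l) (a - b).
Proof. by rewrite lfunE /= bext_bu. Qed.

Definition bcounit : 'Hom(H, k^o) :=
  linfun (bext (fun l a => (a == 0)%:R : k^o)).

Lemma bcounit_bu l a : bcounit (bu l a) = (a == 0)%:R.
Proof. by rewrite lfunE /= bext_bu. Qed.

Lemma tlift_bcomul (U : lmodType k) (F : H -> H -> U) l a :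
  (forall x, linear (F x)) -> (forall y, linear (F^~ y)) ->
  tlift F (bcomul (bu l a)) = \sum_b F (bu l b) (bu (act (- b) l) (a - b)).
Proof.
move=> lr ll; rewrite bcomul_bu linear_sum.
by apply: eq_bigr => b _; rewrite [LHS]tlift_tens.
Qed.

Lemma bcomulA x :
  tlift (fun x1 x2 => tlift (fun x11 x12 => x11 ⊗ (x12 ⊗ x2)) (bcomul x1))
    (bcomul x) =
  tlift (fun x1 x2 => tlift (fun x21 x22 => x1 ⊗ (x21 ⊗ x22)) (bcomul x2))
    (bcomul x).
Proof.
move: x; apply: (@bu_ext _ (fun x => tlift _ (bcomul x))
  (fun x => tlift _ (bcomul x))) => [||l a]; [lin | lin |].
rewrite tlift_bcomul; [|lin|lin].
under eq_bigr => b _ do (rewrite tlift_bcomul; [|lin|lin]).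
rewrite tlift_bcomul; [|lin|lin].
under [RHS]eq_bigr => b _ do (rewrite tlift_bcomul; [|lin|lin]).
rewrite exchange_big; apply: eq_bigr => b _ /=.
(* On both sides [b] is now the K-index of the first leg; the shift by [b] makes [c] that of the
   middle leg. *)
rewrite (reindex_inj (addIr b)); apply: eq_bigr => c _ /=.
by rewrite opprD aactD addrK addrA [a - c - b]addrAC.
Qed.

Lemma bcounitl x :
  tlift (fun x1 x2 => (bcounit x1 : k) *: x2) (bcomul x) = x.
Proof.
move: x; apply: (@bu_ext _ (fun x => tlift _ (bcomul x)) idfun);
  [lin | done |] => l a.
rewrite tlift_bcomul; [|lin|lin].
rewrite (bigD1 0) //= big1 => [|b b0]; last first.
  by rewrite bcounit_bu (negPf b0) scale0r.
by rewrite bcounit_bu eqxx scale1r addr0 subr0 oppr0 aact0.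
Qed.

Lemma bcounitr x :
  tlift (fun x1 x2 => (bcounit x2 : k) *: x1) (bcomul x) = x.
Proof.
move: x; apply: (@bu_ext _ (fun x => tlift _ (bcomul x)) idfun);
  [lin | done |] => l a.
rewrite tlift_bcomul; [|lin|lin].
rewrite (bigD1 a) //= big1 => [|b ba]; last first.
  by rewrite bcounit_bu subr_eq0 eq_sym (negPf ba) scale0r.
by rewrite bcounit_bu subrr eqxx scale1r addr0.
Qed.

Lemma bcounit1 : bcounit 1 = 1.
Proof.
rewrite -bu1E linear_sum (bigD1 0) //= bcounit_bu eqxx big1 ?addr0 //.
by move=> a a0; rewrite bcounit_bu (negPf a0).
Qed.

Lemma bcounit_neq0 : bcounit != 0.
Proof. by apply/lfunPn; exists 1; rewrite bcounit1 lfunE oner_neq0. Qed.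

HB.instance Definition _ := Vector_isCoalgebra.Build k H
  bcomulA bcounitl bcounitr bcounit_neq0.

Lemma Sw_bu (U : lmodType k) (F : H -> H -> U) l a :
  (forall x, linear (F x)) -> (forall y, linear (F^~ y)) ->
  \Sw_(x1, x2 <- bu l a) F x1 x2 =
  \sum_b F (bu l b) (bu (act (- b) l) (a - b)).
Proof. exact: tlift_bcomul. Qed.

Lemma aact_0 a : act a 0 = 0.
Proof. by apply: (addIr (act a 0)); rewrite -aactDr !add0r. Qed.

Lemma aactK a : cancel (act a) (act (- a)).
Proof. by move=> l; rewrite -aactD addNr aact0. Qed.

Lemma aactNK a : cancel (act (- a)) (act a).
Proof. by move=> l; rewrite -aactD addrN aact0. Qed.

Lemma bcomul1 : comul (1 : H) = 1 ⊗ 1.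
Proof.
rewrite -bu1E linear_sum /=.
under eq_bigr => a _ do rewrite [comul _]bcomul_bu.
rewrite (linear_sumF _ _ _ (tens_linearl _)).
under [RHS]eq_bigr => a _ do rewrite (linear_sumF _ _ _ (tens_linearr _)).
rewrite exchange_big; apply: eq_bigr => b _ /=.
rewrite (reindex_inj (addIr b)); apply: eq_bigr => a _ /=.
by rewrite aact_0 addrK.
Qed.

Lemma bcomulM (x y : H) : comul (x * y) =
  \Sw_(x1, x2 <- x) \Sw_(y1, y2 <- y) (x1 * y1) ⊗ (x2 * y2).
Proof.
move: x; apply: (@bu_ext _ (fun x => comul (x * y))
    (fun x => tlift _ (comul x)));
  [by move=> c u v; rewrite mulrDl -scalerAl linearP | lin |] => l a.
move: y; apply: (@bu_ext _ (fun y => comul (_ * y)) (fun y => tlift _ _));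
  [by move=> c u v; rewrite mulrDr -scalerAr linearP | lin |] => m b.
rewrite Sw_bu; [|lin|lin].
under [RHS]eq_bigr => c _ do (rewrite Sw_bu; [|lin|lin]).
rewrite buM; have [->|ab] := eqVneq a b.
  rewrite [LHS]bcomul_bu; apply: eq_bigr => c _.
  (* Only pairs cut at the same [c] survive, and their second legs agree because K acts by
     automorphisms of L. *)
  rewrite (bigD1 c) //= !buM !eqxx aactDr big1 ?addr0 // => d dc.
  by rewrite !buM [c == d]eq_sym (negPf dc) tens0l.
rewrite linear0 big1 // => c _; rewrite big1 // => d _; rewrite !buM.
have [<-|] := eqVneq c d; last by rewrite tens0l.
by rewrite (inj_eq (addIr _)) (negPf ab) tens0r.
Qed.

Lemma bcounitM (x y : H) : counit (x * y) = counit x * counit y.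
Proof.
move: x; apply: (@bu_ext _ (fun x => counit (x * y))
    (fun x => counit x * counit y)) => [||l a];
  [by move=> c u v; rewrite mulrDl -scalerAl linearP | lin |].
move: y; apply: (@bu_ext _ (fun y => counit (_ * y))
    (fun y => counit _ * counit y)) => [||m b];
  [by move=> c u v; rewrite mulrDr -scalerAr linearP | lin |].
rewrite buM ![counit (bu _ _)]bcounit_bu.
have [->|ab] := eqVneq a b; first by rewrite [LHS]bcounit_bu -natrM mulnb andbb.
rewrite linear0 -natrM mulnb; case: eqP => // a0.
by rewrite /= -a0 [b == _]eq_sym (negPf ab).
Qed.

(** Transpose of the antipode of k^L # K, which is an involution of the basis 1_l # a given by the
    same formula. *)
Definition bantipode : 'End(H) :=
  linfun (bext (fun l a => bu (- act (- a) l) (- a))).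

Lemma bantipode_bu l a : bantipode (bu l a) = bu (- act (- a) l) (- a).
Proof. by rewrite lfunE /= bext_bu. Qed.

Lemma bantipodel (x : H) :
  \Sw_(x1, x2 <- x) (bantipode x1 * x2) = (counit x : k)%:A.
Proof.
move: x; apply: (@bu_ext _ (fun x => tlift _ (comul x))
    (fun x => (counit x : k)%:A)) => [||l a]; [lin | lin |].
rewrite Sw_bu; [|lin|lin].
rewrite [counit _]bcounit_bu -bu1E.
under eq_bigr => b _ do rewrite bantipode_bu buM addNr.
have [->|a0] := eqVneq a 0.
  rewrite scale1r (reindex_inj oppr_inj); apply: eq_bigr => b _.
  by rewrite sub0r opprK eqxx.
rewrite scale0r big1 // => b _.
by rewrite -subr_eq0 opprB addrA addNr add0r oppr_eq0 (negPf a0).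
Qed.

Lemma bantipoder (x : H) :
  \Sw_(x1, x2 <- x) (x1 * bantipode x2) = (counit x : k)%:A.
Proof.
move: x; apply: (@bu_ext _ (fun x => tlift _ (comul x))
    (fun x => (counit x : k)%:A)) => [||l a]; [lin | lin |].
rewrite Sw_bu; [|lin|lin].
rewrite [counit _]bcounit_bu -bu1E.
under eq_bigr => b _ do rewrite bantipode_bu buM.
have [->|a0] := eqVneq a 0.
  rewrite scale1r; apply: eq_bigr => b _.
  by rewrite sub0r opprK eqxx aactNK subrr.
rewrite scale0r big1 // => b _.
by rewrite opprB -subr_eq0 opprB addrC subrK (negPf a0).
Qed.

HB.instance Definition _ := Coalgebra_isHopf.Build k H
  bcomul1 bcomulM bcounit1 bcounitM bantipodel bantipoder.

End Bismash.

(** * Lazy cocycles from monomial twists *)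

Section Twists.
Variables (k : fieldType) (L K : finZmodType) (act : additive_action L K).
Local Notation H := (bismash k act).
Local Notation HH := (tensor H H).
Local Notation u := (bu k act).

Lemma dual_bu_ext (f g : dual HH) :
  (forall l a m b, f (u l a ⊗ u m b) = g (u l a ⊗ u m b)) -> f = g.
Proof.
move=> fg; apply/dualP; apply: tensor_ext => [||x y]; try exact: linearP.
move: x; apply: (@bu_ext _ _ _ _ _ (fun x => f (x ⊗ y)) (fun x => g (x ⊗ y)));
  [lin | lin |] => l a.
by move: y; apply: (@bu_ext _ _ _ _ _ (fun y => f (_ ⊗ y))
    (fun y => g (_ ⊗ y)));
  [lin | lin |].
Qed.

Lemma dual_mul_bu (f g : dual HH) l a m b :
  (f * g) (u l a ⊗ u m b) = \sum_a' \sum_b' f (u l a' ⊗ u m b') *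
    g (u (act (- a') l) (a - a') ⊗ u (act (- b') m) (b - b')).
Proof.
rewrite dual_mulE [LHS]tensor_SwE; [|lin|lin].
rewrite Sw_bu; [|lin|lin]; apply: eq_bigr => a' _.
by rewrite Sw_bu //; lin.
Qed.

Lemma dual1_bu l a m b :
  (1 : dual HH) (u l a ⊗ u m b) = ((a == 0) && (b == 0))%:R.
Proof.
rewrite dual_oneE [LHS]tensor_counitE [counit (u l a)]bcounit_bu.
by rewrite [counit (u m b)]bcounit_bu -natrM mulnb.
Qed.

(* Under the pairing of [bismash k act] with the smash product k^L # K, the
   monomial form with data A, B, c is the element
   \sum_(l, m) c(l, m) (1_l # A(l, m)) ⊗ (1_m # B(l, m)). *)
Definition mono (A B : L -> L -> K) (c : L -> L -> k) : dual HH :=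
  linfun (tlift (fun x y : H => bext (fun l a => bext (fun m b =>
    (if (a == A l m) && (b == B l m) then c l m else 0) : k^o) y) x)).

Lemma mono_bu A B c l a m b : mono A B c (u l a ⊗ u m b) =
  if (a == A l m) && (b == B l m) then c l m else 0.
Proof.
rewrite lfunE /= tlift_tens ?bext_bu // => [x|y]; last exact: bext_linear.
by apply: bext_linearP => ? ?; apply: bext_linear.
Qed.

Lemma sum_mono (V : lmodType k) A B c l m (F : K -> K -> V) :
  \sum_a \sum_b (mono A B c (u l a ⊗ u m b) : k) *: F a b =
  c l m *: F (A l m) (B l m).
Proof.
rewrite (bigD1 (A l m)) //= (bigD1 (B l m)) //= mono_bu !eqxx /=.
rewrite !big1 ?addr0 // => [a aA | b bB]; last first.
  by rewrite mono_bu (negPf bB) andbF scale0r.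
by rewrite big1 // => b _; rewrite mono_bu (negPf aA) scale0r.
Qed.

Lemma mono_mulE A B c (g : dual HH) l a m b :
  (mono A B c * g) (u l a ⊗ u m b) =
  c l m * g (u (act (- A l m) l) (a - A l m) ⊗
             u (act (- B l m) m) (b - B l m)).
Proof. by rewrite dual_mul_bu (sum_mono (V := k^o)). Qed.

(** A product of monomial forms is monomial: the second factor is evaluated at arguments shifted by
    the first, K-parts add and scalars multiply. The unit has data 0, 0, 1. *)
Lemma mono_mul1 A B c A' B' c' :
  (forall l m, let l' := act (- A l m) l in let m' := act (- B l m) m in
    [/\ A l m + A' l' m' = 0, B l m + B' l' m' = 0 & c l m * c' l' m' = 1]) ->
  mono A B c * mono A' B' c' = 1.
Proof.
move=> AB; apply: dual_bu_ext => l a m b.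
rewrite mono_mulE mono_bu dual1_bu; case: (AB l m) => /eqP A0 /eqP B0 c1.
rewrite -[_ - _ == _]subr_eq0 -[b - _ == _]subr_eq0 -!addrA -!opprD.
by rewrite (eqP A0) (eqP B0) !subr0; case: ifP; rewrite ?c1 ?mulr0.
Qed.

Lemma scale_mull_linear (c : k) (y : H) : linear (fun x : H => c *: (x * y)).
Proof.
by move=> d v w; rewrite mulrDl -scalerAl scalerDr !scalerA [c * d]mulrC.
Qed.

Lemma scale_mulr_linear (c : k) (x : H) : linear (fun y : H => c *: (x * y)).
Proof.
by move=> d v w; rewrite mulrDr -scalerAr scalerDr !scalerA [c * d]mulrC.
Qed.

Lemma mul_form_linear (V : lmodType k) (c : k) (f : V -> k^o) :
  linear f -> linear (fun x => c * f x : k^o).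
Proof. by move=> lf d v w; rewrite lf mulrDr; congr (_ + _); apply: mulrCA. Qed.

Local Ltac lins := intros; cbv beta;
  first [ exact: scale_mull_linear | exact: scale_mulr_linear
        | apply: tlift_linearP => ? ?; lins | lin
        | apply: mul_form_linear => ? ? ?;
          by rewrite ?(mulrDl, mulrDr) -?scalerAl -?scalerAr ?(tensPl, tensPr)
            linearP ].

(** * Laziness and the cocycle identity for monomial forms *)

Section LazyMono.
Variables (A B : L -> L -> K) (c : L -> L -> k).
Hypothesis actA : forall a l m, A (act a l) (act a m) = A l m.
Hypothesis actB : forall a l m, B (act a l) (act a m) = B l m.
Hypothesis actc : forall a l m, c (act a l) (act a m) = c l m.
Hypothesis AB_add :
  forall l m, act (- A l m) l + act (- B l m) m = l + m.

(** Laziness is commutation with Δ(k^L # K). [AB_add] gives commutation with Δ(k^L), and the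
    invariance of [A], [B], [c] gives commutation with the a ⊗ a for a in K, as K is abelian. *)
Lemma mono_lazy (x y : H) :
  \Sw_(x1, x2 <- x) \Sw_(y1, y2 <- y)
    (mono A B c (x1 ⊗ y1) : k) *: (x2 * y2) =
  \Sw_(x1, x2 <- x) \Sw_(y1, y2 <- y)
    (mono A B c (x2 ⊗ y2) : k) *: (x1 * y1).
Proof.
move: x; apply: (@bu_ext _ _ _ _ _ (fun x => tlift _ (comul x))
  (fun x => tlift _ (comul x))) => [||l a]; [lins | lins |].
move: y; apply: (@bu_ext _ _ _ _ _ (fun y => tlift _ _)
  (fun y => tlift _ _)) => [||m b]; [lins | lins |].
rewrite Sw_bu; [|lins|lins].
under eq_bigr => a' _ do (rewrite Sw_bu; [|lins|lins]).
rewrite sum_mono Sw_bu; [|lins|lins].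
under [RHS]eq_bigr => a' _ do (rewrite Sw_bu; [|lins|lins]).
rewrite buM AB_add.
(* The product [u l a' * u m b'] vanishes unless b' = a', so one element of K moves both l and m and
   the invariance hypotheses apply. *)
transitivity (\sum_a' (mono A B c
    (u (act (- a') l) (a - a') ⊗ u (act (- a') m) (b - a')) : k) *:
    u (l + m) a'); last first.
  apply: eq_bigr => a' _; rewrite (bigD1 a') //= buM eqxx big1 ?addr0 // => b'.
  by rewrite buM eq_sym => /negPf ->; rewrite scaler0.
have E a' : (a - a' == A l m) = (a' == a - A l m).
  by rewrite -subr_eq0 addrAC subr_eq0 eq_sym.
have E' b' : (b - b' == B l m) = (b' == b - B l m).
  by rewrite -subr_eq0 addrAC subr_eq0 eq_sym.
rewrite (bigD1 (a - A l m)) //= big1 => [|a' ne]; last first.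
  by rewrite mono_bu actA E (negPf ne) scale0r.
by rewrite mono_bu actA actB actc E E' eqxx addr0; case: ifP => // _;
  rewrite ?scale0r ?scaler0.
Qed.

Hypothesis A_coc : forall l m n, A l m + A (l + m) n = A l (m + n).
Hypothesis AB_coc : forall l m n, B l m + A (l + m) n = A m n + B l (m + n).
Hypothesis B_coc : forall l m n, B (l + m) n = B m n + B l (m + n).
Hypothesis c_coc : forall l m n, c l m * c (l + m) n = c m n * c l (m + n).

(** The hypotheses [A_coc], [AB_coc], [B_coc] are the twist equation on the K-parts of the three
    legs, and [c_coc] is the one on scalars. Shifts of the arguments disappear since [AB_add]
    preserves their sums. *)
Lemma mono_cocycle (x y z : H) : let s := mono A B c in
  \Sw_(x1, x2 <- x) \Sw_(y1, y2 <- y) s (x1 ⊗ y1) * s ((x2 * y2) ⊗ z) =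
  \Sw_(y1, y2 <- y) \Sw_(z1, z2 <- z) s (y1 ⊗ z1) * s (x ⊗ (y2 * z2)).
Proof.
move=> s; move: x; apply: (@bu_ext _ _ _ _ k^o (fun x => tlift _ (comul x))
  (fun x => tlift (fun y1 y2 => tlift (fun z1 z2 => _ * s (x ⊗ _)) _) _))
  => [||l a]; [lins | lins |].
move: y; apply: (@bu_ext _ _ _ _ k^o (fun y => tlift _ _)
  (fun y => tlift _ (comul y))) => [||m b]; [lins | lins |].
move: z; apply: (@bu_ext _ _ _ _ k^o
  (fun z => tlift (fun x1 x2 => tlift (fun y1 y2 => _ * s (_ ⊗ z)) _) _)
  (fun z => tlift _ _)) => [||n e]; [lins | lins |].
rewrite Sw_bu; [|lins|lins].
under eq_bigr => a' _ do (rewrite Sw_bu; [|lins|lins]).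
rewrite (sum_mono (V := k^o)) Sw_bu; [|lins|lins].
under [RHS]eq_bigr => a' _ do (rewrite Sw_bu; [|lins|lins]).
rewrite (sum_mono (V := k^o)) !buM !AB_add.
have s0l v : s (0 ⊗ v) = 0 by rewrite tens0l linear0.
have s0r v : s (v ⊗ 0) = 0 by rewrite tens0r linear0.
(* Both sides are the same monomial form on three legs; the equality tests amount to one condition
   on each of a, b and e. *)
transitivity (if [&& a == A l m + A (l + m) n, b == B l m + A (l + m) n &
    e == B (l + m) n] then c l m * c (l + m) n else 0).
  rewrite [A l m + _]addrC [B l m + _]addrC.
  rewrite -[a == _]subr_eq -[b == _]subr_eq.
  have [<-|ne] := eqVneq (a - A l m) (b - B l m).
    rewrite /s /= mono_bu andbA andbb; case: ifP => _ //; exact: scaler0.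
  rewrite s0l scaler0; case: eqP => //= <-.
  by rewrite eq_sym (negPf ne).
rewrite A_coc AB_coc B_coc c_coc [A m n + _]addrC [B m n + _]addrC.
rewrite -[b == _]subr_eq -[e == _]subr_eq.
have [<-|ne] := eqVneq (b - A m n) (e - B m n).
  rewrite /s /= mono_bu andbb; case: ifP => _ //; exact/esym/scaler0.
rewrite s0r scaler0 andbC; case: eqP => //= <-.
by rewrite eq_sym (negPf ne).
Qed.
End LazyMono.

(** * Twists from additive maps that act through K on each orbit *)

Section LazyTwist.
Variables (kappa : L -> K) (c : L -> L -> k).
Hypothesis act_kappa : forall a l, kappa (act a l) = kappa l.
Hypothesis kappa_add : forall l m,
  act (- kappa (l + m)) (l + m) = act (- kappa l) l + act (- kappa m) m.
Hypothesis actc : forall a l m, c (act a l) (act a m) = c l m.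
Hypothesis c_neq0 : forall l m, c l m != 0.
Hypothesis c_coc : forall l m n, c l m * c (l + m) n = c m n * c l (m + n).

(* The element c (y ⊗ y) Δ(y^-1) of A ⊗ A, A = k^L # K, for the unit
   y = \sum_l 1_l # kappa(l) of A. *)
Definition twist : dual HH :=
  mono (fun l m => kappa l - kappa (l + m))
       (fun l m => kappa m - kappa (l + m)) c.

(** As [kappa] is constant on orbits, this map is inverse to the additive map of [kappa_add], hence
    additive too. *)
Let Kadd l m : act (kappa (l + m)) (l + m) = act (kappa l) l + act (kappa m) m.
Proof.
set l' := act (kappa l) l; set m' := act (kappa m) m.
have E : act (- kappa (l' + m')) (l' + m') = l + m.
  by rewrite kappa_add !act_kappa !aactK.
by rewrite -E act_kappa aactNK.
Qed.

(** With S(l) = [act (- kappa l) l], the left side is kappa(l + m) applied to S(l) + S(m) = S(l +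
    m), that is, l + m. *)
Lemma twist_shift l m : act (- (kappa l - kappa (l + m))) l +
  act (- (kappa m - kappa (l + m))) m = l + m.
Proof. by rewrite !opprB !aactD -aactDr -kappa_add aactNK. Qed.

Lemma twist_shiftV l m : act (- (kappa (l + m) - kappa l)) l +
  act (- (kappa (l + m) - kappa m)) m = l + m.
Proof.
rewrite !opprB [kappa l - _]addrC [kappa m - _]addrC !aactD.
by rewrite -aactDr -Kadd aactK.
Qed.

Lemma twist_unit : twist \is a GRing.unit.
Proof.
(* The inverse has opposite K-parts; its scalar inverts [c] at the shifted arguments, where the
   product evaluates [twist]. *)
pose c' l m := (c (act (- (kappa (l + m) - kappa l)) l)
                  (act (- (kappa (l + m) - kappa m)) m))^-1.
apply/unitrP; exists (mono (fun l m => kappa (l + m) - kappa l)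
  (fun l m => kappa (l + m) - kappa m) c').
split; apply: mono_mul1 => l m l' m'.
  have E : l' + m' = l + m := twist_shiftV l m.
  rewrite E !act_kappa !subrKA ?subrr; split => //.
  by rewrite /c' mulVf.
have E : l' + m' = l + m := twist_shift l m.
rewrite E !act_kappa !subrKA ?subrr; split => //.
rewrite /c' E !act_kappa /l' /m' -!aactD !opprB.
by rewrite !subrKA !subrr !aact0 mulfV.
Qed.

(** The K-parts are differences of values of [kappa], so their cocycle identities telescope. *)
Lemma twist_lazyZ2 : lazyZ2 H twist.
Proof.
have actS l m a : kappa (act a l + act a m) = kappa (l + m).
  by rewrite -aactDr act_kappa.
split; first split.
- exact: twist_unit.
- apply: mono_lazy; try by move=> a l m; rewrite ?actS ?act_kappa.
  exact: twist_shift.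
- apply: mono_cocycle => //;
    try by move=> l m n; rewrite ?[l + (m + n)]addrA ?subrKA.
  exact: twist_shift.
Qed.
End LazyTwist.

(** * Flip invariance as an obstruction to commuting *)

Definition flip_invariant (f : dual HH) : Prop :=
  forall x y, f (x ⊗ y) = f (y ⊗ x).

Lemma flip_mul (f g : dual HH) :
  flip_invariant f -> flip_invariant g -> flip_invariant (f * g).
Proof.
move=> ff gg x y; rewrite !dual_mulE [LHS]tensor_SwE; [|lin|lin].
rewrite [RHS]tensor_SwE; [|lin|lin]; rewrite tlift_exchange.
apply: eq_tlift => y1 y2; apply: eq_tlift => x1 x2.
by rewrite ff gg.
Qed.

Lemma flip_bu (f : dual HH) :
  (forall l a m b, f (u l a ⊗ u m b) = f (u m b ⊗ u l a)) -> flip_invariant f.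
Proof.
move=> ff x y; move: x; apply: (@bu_ext _ _ _ _ _ (fun x => f (x ⊗ y))
  (fun x => f (y ⊗ x))) => [||l a]; [lin | lin |].
by move: y; apply: (@bu_ext _ _ _ _ _ (fun y => f (_ ⊗ y))
    (fun y => f (y ⊗ _)));
  [lin | lin |].
Qed.

Lemma flip_coboundary (l : dual H) : flip_invariant (coboundary l).
Proof.
move=> x y; rewrite !coboundaryE tlift_exchange.
apply: eq_tlift => y1 y2; apply: eq_tlift => x1 x2.
by rewrite [l x1 * _]mulrC [x2 * y2]bmulC.
Qed.

(** The equation determines [mu] at suitable basis vectors as the ratio c(l', m') / c(l, m); flip
    invariance equates it with c(m', l') / c(m, l). The conclusion is this equality
    cross-multiplied. *)
Lemma twist_commutator (kappa : L -> K) (c : L -> L -> k) (mu : dual HH) l m :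
    twist kappa (fun _ _ => 1) * twist (fun=> 0) c = twist (fun=> 0) c * mu ->
    flip_invariant mu ->
  let l' := act (- (kappa l - kappa (l + m))) l in
  let m' := act (- (kappa m - kappa (l + m))) m in
  c l' m' * c m l = c l m * c m' l'.
Proof.
move=> E fmu l' m'.
(* The K-indices are those at which the first twist is nonzero; after their subtraction the second
   one, which has zero K-parts, is evaluated at K-indices 0. *)
have ev p q : c (act (- (kappa p - kappa (p + q))) p)
    (act (- (kappa q - kappa (p + q))) q) = c p q *
    mu (u p (kappa p - kappa (p + q)) ⊗ u q (kappa q - kappa (p + q))).
  have := congr1 (fun f : dual HH => f (u p (kappa p - kappa (p + q)) ⊗
    u q (kappa q - kappa (p + q)))) E.
  rewrite !mono_mulE mono_bu !subrr eqxx mul1r => ->.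
  by rewrite !oppr0 !aact0 !addr0.
have := ev m l; rewrite [m + l]addrC fmu -/l' -/m' => ->.
by rewrite [c l' m']ev mulrAC mulrA [_ * c m l * _]mulrAC.
Qed.

Lemma coboundary1 : coboundary (1 : dual H) = 1.
Proof.
apply/dualP; apply: tensor_ext => [||x y]; try exact: linearP.
rewrite coboundaryE -[in RHS](mulr1 1) dual_mulE [RHS]tensor_SwE; [|lin|lin].
apply: eq_tlift => x1 x2; apply: eq_tlift => y1 y2.
by rewrite invr1 !dual_oneE counitM ![counit (_ ⊗ _)]tensor_counitE.
Qed.

(** Puts each cocycle in its own coset; the counit is the lazy form with coboundary 1. *)
Lemma lazyB2_1 : lazyB2 H 1.
Proof.
exists 1; last exact: coboundary1.
split=> [|x]; first exact: unitr1.
by rewrite [LHS]counitl [RHS]counitr.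
Qed.
End Twists.

(** * Two lazy cocycles over F_3 *)

Local Notation F := 'F_3.

HB.instance Definition _ (A B : finZmodType) := Finite.on (A * B)%type.

Definition L3 : finZmodType := (F * F * F * F)%type.
Definition K3 : finZmodType := (F * F)%type.

Definition act_fun (a : K3) (l : L3) : L3 :=
  let: (s, t) := a in let: (x1, x2, y1, y2) := l in
  (x1 + s * y1, x2 + t * y1 + s * y2, y1, y2).

Lemma act_fun0 : act_fun 0 =1 id.
Proof.
by move=> [[[x1 x2] y1] y2]; rewrite /act_fun /= !mul0r !addr0.
Qed.

Lemma act_funD a b l : act_fun (a + b) l = act_fun a (act_fun b l).
Proof.
move: a b l => [s t] [s' t'] [[[x1 x2] y1] y2]; rewrite /act_fun /=.
by congr (_, _, _, _); ring.
Qed.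

Lemma act_funDr a l m : act_fun a (l + m) = act_fun a l + act_fun a m.
Proof.
move: a l m => [s t] [[[x1 x2] y1] y2] [[[x1' x2'] y1'] y2'].
rewrite /act_fun /=.
by congr (_, _, _, _); rewrite /=; ring.
Qed.

Definition act3 := AdditiveAction act_fun0 act_funD act_funDr.

(* The shear x1 |-> x1 + y1 acts on the K-orbit of l as [kappa3 l], because
   y1^3 = y1 over F_3. *)
Definition kappa3 (l : L3) : K3 :=
  let: (x1, x2, y1, y2) := l in (y1 ^+ 2, - (y1 * y2)).

Lemma act_kappa3 a l : kappa3 (act3 a l) = kappa3 l.
Proof. by move: a l => [s t] [[[x1 x2] y1] y2]. Qed.

Lemma F3_cube (y : F) : y ^+ 3 = y.
Proof. by case: y => [[|[|[]]] //= lt3]; apply: val_inj. Qed.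

(** The first coordinate moves by y1^3 = y1, and in the second the two terms y1^2 y2 cancel. Thus
    the quadratic [kappa3] yields a linear map, the inverse shear. *)
Lemma act_kappa3N l : act3 (- kappa3 l) l =
  let: (x1, x2, y1, y2) := l in (x1 - y1, x2, y1, y2).
Proof.
move: l => [[[x1 x2] y1] y2] /=.
by congr (_, _, _, _); [rewrite -[X in _ = _ - X]F3_cube; ring | ring].
Qed.

Lemma kappa3_add l m :
  act3 (- kappa3 (l + m)) (l + m) = act3 (- kappa3 l) l + act3 (- kappa3 m) m.
Proof.
rewrite !act_kappa3N; move: l m => [[[x1 x2] y1] y2] [[[x1' x2'] y1'] y2'] /=.
by congr (_, _, _, _); rewrite /=; ring.
Qed.

(** The symplectic form pairing x1 with y2 and x2 with y1. K preserves it, whereas the shear x1 |->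
    x1 + y1 adds y1 y2' - y2 y1' to it. *)
Definition beta3 (l m : L3) : F :=
  let: (x1, x2, y1, y2) := l in let: (x1', x2', y1', y2') := m in
  x1 * y2' + x2 * y1' - y2 * x1' - y1 * x2'.

Lemma act_beta3 a l m : beta3 (act3 a l) (act3 a m) = beta3 l m.
Proof.
move: a l m => [s t] [[[x1 x2] y1] y2] [[[x1' x2'] y1'] y2'] /=; ring.
Qed.

Lemma beta3Dl l m n : beta3 (l + m) n = beta3 l n + beta3 m n.
Proof.
move: l m n => [[[x1 x2] y1] y2] [[[x1' x2'] y1'] y2'] [[[p q] r] s] /=; ring.
Qed.

Lemma beta3Dr l m n : beta3 l (m + n) = beta3 l m + beta3 l n.
Proof.
move: l m n => [[[x1 x2] y1] y2] [[[x1' x2'] y1'] y2'] [[[p q] r] s] /=; ring.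
Qed.

Section Noncommuting.
Variables (k : fieldType) (z : k).
Hypothesis z3 : 3.-primitive_root z.

Definition char3 (x : F) : k := z ^+ x.

(** Addition in F_3 is addition of representatives modulo 3, the order of [z]. *)
Lemma char3D x y : char3 (x + y) = char3 x * char3 y.
Proof. by rewrite -exprD -(prim_expr_mod z3 (x + y)%N). Qed.

Lemma char3_neq0 x : char3 x != 0.
Proof.
apply: expf_neq0; apply: contra_eq_neq (prim_expr_order z3) => ->.
by rewrite expr0n eq_sym oner_neq0.
Qed.

Definition sigma : dual (tensor (bismash k act3) (bismash k act3)) :=
  twist act3 kappa3 (fun _ _ => 1).

(** With [kappa] = 0 the K-parts vanish, which leaves the bicharacter [char3] o [beta3] in k^L ⊗
    k^L. *)
Definition tau : dual (tensor (bismash k act3) (bismash k act3)) :=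
  twist act3 (fun=> 0) (fun l m => char3 (beta3 l m)).

Lemma sigma_lazyZ2 : lazyZ2 (bismash k act3) sigma.
Proof.
apply: twist_lazyZ2 => // [||l m]; last exact: oner_neq0.
  exact: act_kappa3.
exact: kappa3_add.
Qed.

Lemma tau_lazyZ2 : lazyZ2 (bismash k act3) tau.
Proof.
apply: twist_lazyZ2 => // [l m | a l m | l m | l m n].
- by rewrite oppr0 !aact0.
- by rewrite act_beta3.
- exact: char3_neq0.
- by rewrite -!char3D beta3Dl beta3Dr addrA addrC.
Qed.

Lemma flip_sigma : flip_invariant sigma.
Proof.
by apply: flip_bu => l a m b; rewrite !mono_bu [m + l]addrC andbC.
Qed.

(** Here [b] and [b'] stand for the coboundaries by which coset representatives vary. As [sigma] is
    flip invariant, b sigma b' can serve as [mu] in [twist_commutator]. *)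
Lemma sigma_tau_neq b b' : flip_invariant b -> flip_invariant b' ->
  sigma * tau != tau * b * (sigma * b').
Proof.
move=> fb fb'; apply/eqP; rewrite -mulrA => E.
have fmu : flip_invariant (b * (sigma * b')).
  by apply/flip_mul/flip_mul => //; apply: flip_sigma.
(* The y1- and y2-directions: [beta3] vanishes on this pair, but y1 y2' - y2 y1' is 1 there. *)
pose l : L3 := (0, 0, 1, 0); pose m : L3 := (0, 0, 0, 1).
have := twist_commutator l m E fmu; lazy zeta beta.
set l' := act3 _ l; set m' := act3 _ m.
have -> : beta3 l' m' = -1 by rewrite /=; ring.
have -> : beta3 m' l' = 1 by rewrite /=; ring.
have -> : beta3 l m = 0 by rewrite /=; ring.
have -> : beta3 m l = 0 by rewrite /=; ring.
(* What remains is char3(-1) = char3(1), that is z^2 = z, as -1 is represented by 2. *)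
rewrite mulr1 mul1r => /eqP.
by rewrite (eq_prim_root_expr z3).
Qed.
End Noncommuting.

Theorem corollary1p11 :
  exists (k : fieldType) (H : hopfAlgType k),
    [pchar k] =i pred0 /\
    ~ (forall A B : set (dual (tensor H H)),
         lazyH2 H A -> lazyH2 H B -> coset_mul A B = coset_mul B A).
Proof.
have [z z3] := C_prim_root_exists (isT : (0 < 3)%N).
exists algC, (bismash algC act3); split; first exact: Num.Theory.pchar_num.
move=> /(_ _ _ (imageP _ (sigma_lazyZ2 algC)) (imageP _ (tau_lazyZ2 z3))) E.
have B1 : lazyB2 (bismash algC act3) 1 by apply: lazyB2_1.
have : coset_mul [set sigma algC * b | b in lazyB2 (bismash algC act3)]%classic
  [set tau z * b | b in lazyB2 (bismash algC act3)]%classic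
  (sigma algC * tau z).
  exists (sigma algC); first by exists 1 => //; rewrite mulr1.
  by exists (tau z) => //; exists 1 => //; rewrite mulr1.
(* If the cosets commuted, [sigma * tau] would have the form (tau b)(sigma b') with b and b'
   coboundaries. *)
rewrite E => -[_ [_ [l _ <-] <-]] [_ [_ [l' _ <-] <-]] /esym/eqP.
by rewrite (negPf (sigma_tau_neq z3 _ _)) //; apply: flip_coboundary.
Qed.
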